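(* Let $P$ be a labeled poset. If the multivariate $P$-Eulerian polynomial $A_P(\mathbf{z})$ is stable, then the multivariate peak polynomial $\bar{A}_P(\mathbf{z})$ is Hurwitz stable and the univariate peak polynomial $\bar{A}_P(x)$ is real-rooted.
   Context: Write $[n]=\{1,\dots,n\}$ and let $[n]'=\{i':i\in[n]\}$ be a disjoint copy. A labeled poset on $n$ elements is a poset $P=([n],\preceq)$. Its Jordan–Hölder set is $\mathscr{L}(P)=\{\pi\in\mathfrak{S}_n:\text{for all } i,j\in[n],\ \pi_i\preceq\pi_j\text{ implies } i\leq j\}$ (permutations in one-line notation). For $\pi\in\mathfrak{S}_n$ set $\pi_0=\pi_{n+1}=\infty$ and $\mathrm{AB}(\pi)=\{\pi_i\in[n]:\pi_i<\pi_{i+1}\}$, $\mathrm{DB}(\pi)=\{\pi_i\in[n]:\pi_{i-1}>\pi_i\}$. The multivariate $P$-Eulerian polynomial, in variables $z_e$, $e\in[n]\cup[n]'$, is $$A_P(\mathbf{z})=\sum_{\pi\in\mathscr{L}(P)}\ \prod_{e\in\mathrm{DB}(\pi)}z_e\prod_{e\in\mathrm{AB}(\pi)}z_{e'}.$$ A peak of $\pi\in\mathfrak{S}_n$ is an index $1<i<n$ with $\pi_{i-1}<\pi_i>\pi_{i+1}$; $\Lambda(\pi)$ is the set of peaks, and the peak polynomial is $\bar{A}_P(x)=\sum_{\pi\in\mathscr{L}(P)}x^{|\Lambda(\pi)|}$. The peak-valley set of $\pi$ is (with $\pi_0=\pi_{n+1}=\infty$) $$N(\pi)=\{\pi_i:\pi_{i-1}<\pi_i>\pi_{i+1},\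 i\in[n]\}\cup\{\pi_i:\pi_{i-1}>\pi_i<\pi_{i+1},\ i\in[n]\},$$ and the multivariate peak polynomial, in variables $z_1,\dots,z_n$, is $\bar{A}_P(\mathbf{z})=\sum_{\pi\in\mathscr{L}(P)}\prod_{e\in N(\pi)}z_e$. A complex polynomial is stable if it is nonzero whenever all its variables have positive imaginary parts, and Hurwitz stable if it is nonzero whenever all its variables have positive real parts. A univariate real polynomial is real-rooted if all its zeros are real (in particular nonzero constants are real-rooted). *)

(* Defs.v *)
From HB Require Import structures.
From mathcomp Require Import all_boot all_order all_fingroup all_algebra.
From mathcomp Require Import mpoly complex.
From mathcomp Require Import reals.

Set Implicit Arguments.
Unset Strict Implicit.
Unset Printing Implicit Defensive.

Import GRing.Theory Num.Theory.
Local Open Scope ring_scope.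

(* [n] is 'I_n: the ordinal k stands for the label (or position) k.+1, which
   leaves all comparisons of labels unchanged. *)
Record labeled_poset (n : nat) := LabeledPoset {
  lp_le :> rel 'I_n;
  lp_refl : reflexive lp_le;
  lp_anti : antisymmetric lp_le;
  lp_trans : transitive lp_le
}.

Definition jordan_holder n (P : labeled_poset n) : {set 'S_n} :=
  [set pi : 'S_n | [forall i, forall j, P (pi i) (pi j) ==> (i <= j)%N]].

(* letter pi k is pi_k of the one-line word with 1-based positions, extended by
   pi_0 = pi_(n+1) = infinity.  Infinity is encoded as n, which is larger than
   every label.  Hence the entry pi i, for i : 'I_n, is the letter at i.+1, with
   neighbours at i and i.+2. *)
Definition letter n (pi : 'S_n) (k : nat) : nat :=
  nth n (n :: [seq val (pi i) | i <- enum 'I_n]) k.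

Lemma letter0 n (pi : 'S_n) : letter pi 0 = n.
Proof. by []. Qed.

Lemma letterS n (pi : 'S_n) (i : 'I_n) : letter pi i.+1 = pi i.
Proof.
by rewrite /letter /= (nth_map i) ?size_enum_ord // nth_ord_enum.
Qed.

Lemma letter_last n (pi : 'S_n) : letter pi n.+1 = n.
Proof. by rewrite /letter /= nth_default // size_map size_enum_ord. Qed.

Definition ascent_bottoms n (pi : 'S_n) : {set 'I_n} :=
  [set pi i | i : 'I_n & (letter pi i.+1 < letter pi i.+2)%N].

Definition descent_bottoms n (pi : 'S_n) : {set 'I_n} :=
  [set pi i | i : 'I_n & (letter pi i > letter pi i.+1)%N].

(* The variable z_e is 'X_(lshift n e) and z_e' is 'X_(rshift n e). *)
Definition mv_eulerian (K : comNzRingType) n (P : labeled_poset n) :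
    {mpoly K[n + n]} :=
  \sum_(pi in jordan_holder P)
    (\prod_(e in descent_bottoms pi) 'X_(lshift n e)) *
    (\prod_(e in ascent_bottoms pi) 'X_(rshift n e)).

Definition peaks n (pi : 'S_n) : {set 'I_n} :=
  [set i : 'I_n | (1 < i.+1 < n)%N &&
     ((letter pi i < letter pi i.+1) && (letter pi i.+1 > letter pi i.+2))%N].

Definition peak_poly (K : nzRingType) n (P : labeled_poset n) : {poly K} :=
  \sum_(pi in jordan_holder P) 'X^#|peaks pi|.

Definition peak_valley_set n (pi : 'S_n) : {set 'I_n} :=
  [set pi i | i : 'I_n &
    ((letter pi i < letter pi i.+1) && (letter pi i.+1 > letter pi i.+2))%N] :|:
  [set pi i | i : 'I_n &
    ((letter pi i > letter pi i.+1) && (letter pi i.+1 < letter pi i.+2))%N].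

Definition mv_peak (K : comNzRingType) n (P : labeled_poset n) :
    {mpoly K[n]} :=
  \sum_(pi in jordan_holder P) \prod_(e in peak_valley_set pi) 'X_e.

Definition stable (R : realType) m (p : {mpoly R[i][m]}) : Prop :=
  forall z : 'I_m -> R[i], (forall j, 0 < complex.Im (z j)) -> p.@[z] != 0.

Definition hurwitz_stable (R : realType) m (p : {mpoly R[i][m]}) : Prop :=
  forall z : 'I_m -> R[i], (forall j, 0 < complex.Re (z j)) -> p.@[z] != 0.

Definition real_rooted (R : realType) (p : {poly R}) : Prop :=
  forall x : R[i], root (map_poly (real_complex R) p) x -> complex.Im x = 0.

(* Main.v *)
(* On the diagonal z_e = z_e' = t_e, a letter e contributes 1 to A_P if it is a
   peak, t_e^2 if it is a valley and t_e otherwise.  For each e in turn, if the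
   quadratic a + m t + b t^2 has no zero in the upper half-plane, then
   a z + i m - b z <> 0 for Re z > 0: this turns the weights into z_e, -z_e and i.
   Every word has exactly one more valley than peaks (for n > 0), so the signs and
   powers of i are the same for all words, and factoring them out leaves the
   multivariate peak polynomial.  Putting all its variables equal to y gives
   y times the peak polynomial at y^2, and every nonreal x is y^2 for some y with
   Re y > 0. *)

Require Import Defs.
From HB Require Import structures.
From mathcomp Require Import all_boot all_order all_fingroup all_algebra.
From mathcomp Require Import mpoly complex.
From mathcomp Require Import reals.
From mathcomp Require Import ring lra zify.

Import Order.TTheory GRing.Theory Num.Theory.
Local Open Scope ring_scope.

(** * From the upper half-plane to the right half-plane *)

(** For v = cot x and s = cot y the quotient is cot (x - y), and cot reverses the sign of the
    imaginary part. The explicit formula for the imaginary part also covers v = i and s = -i, which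
    are not cotangents. *)
Lemma Im_cotangent_gt0 {R : realType} {s v : R[i]} :
  complex.Im s <= 0 -> 0 < complex.Im v ->
  0 < complex.Im ((1 + s * v) / (s - v)).
Proof.
move=> s_le0 v_gt0.
have : s - v != 0.
  by apply: contraTneq v_gt0 => /subr0_eq <-; rewrite -leNgt.
case: s v s_le0 v_gt0 => [a b] [c d] /= b_le0 d_gt0.
rewrite eq_complex /= negb_and => sv_neq0.
have N_gt0 : 0 < (a - c) ^+ 2 + (b - d) ^+ 2.
  by apply: ltr_wpDl; [exact: sqr_ge0|rewrite exprn_even_gt0 //=; lra].
rewrite [X in 0 < X](_ : _ =
  (- b * (1 + c ^+ 2 + d ^+ 2) + d * (1 + a ^+ 2 + b ^+ 2)) /
   ((a - c) ^+ 2 + (b - d) ^+ 2)); last by field; rewrite gt_eqF.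
rewrite divr_gt0 // ltr_wpDl //.
  by rewrite mulr_ge0 ?oppr_ge0 // !addr_ge0 ?sqr_ge0.
by rewrite mulr_gt0 // -addrA ltr_pwDl // addr_ge0 ?sqr_ge0.
Qed.

(* If [t1], [t2] are the roots of [a + m t + b t^2], the forbidden equation reads
   [v = (t1 t2 - 1) / (t1 + t2)], the addition formula of the cotangent; solved
   for [t1], it puts [t1] or [t2] in the upper half-plane. *)
Lemma quadratic_cotangent_neq0 {R : realType} {a m b v : R[i]} :
  (forall t : R[i], 0 < complex.Im t -> a + m * t + b * t ^+ 2 != 0) ->
  0 < complex.Im v -> a + m * v - b != 0.
Proof.
move=> q_neq0 v_gt0; apply/eqP => abmv.
have a_def : a = b - m * v by rewrite -[LHS]subr0 -abmv; ring.
(* If b = 0, the forbidden equation says that [v] itself is a root. *)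
have [b0|b_neq0] := eqVneq b 0.
  by have /eqP[] := q_neq0 v v_gt0; rewrite a_def b0; ring.
pose d := sqrtc (m ^+ 2 - 4 * b * a).
have dE : d ^+ 2 = m ^+ 2 - 4 * b * a by rewrite sqr_sqrtc.
pose t1 := (- m - d) / 2 / b; pose t2 := (- m + d) / 2 / b.
have root_le0 t : a + m * t + b * t ^+ 2 = 0 -> complex.Im t <= 0.
  by move=> qt; rewrite leNgt; apply/negP => /q_neq0; rewrite qt eqxx.
have qE t : a + m * t + b * t ^+ 2 = b * (t - t1) * (t - t2).
  apply/eqP; rewrite -subr_eq0; apply/eqP.
  transitivity ((d ^+ 2 - (m ^+ 2 - 4 * b * a)) / (4 * b)).
    by rewrite /t1 /t2; field; rewrite b_neq0.
  by rewrite dE subrr mul0r.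
have t1_le0 : complex.Im t1 <= 0 by apply: root_le0; rewrite qE subrr; ring.
have t2_le0 : complex.Im t2 <= 0 by apply: root_le0; rewrite qE subrr; ring.
have t2v : t2 - v != 0.
  by apply: contraTneq v_gt0 => /subr0_eq <-; rewrite -leNgt.
suff t1E : t1 = (1 + t2 * v) / (t2 - v).
  by have := Im_cotangent_gt0 t2_le0 v_gt0; rewrite -t1E ltNge t1_le0.
apply: (mulIf t2v); rewrite divfK //.
apply: (mulfI b_neq0).
have sumE : b * (t1 + t2) = - m by rewrite /t1 /t2; field; rewrite b_neq0.
have prodE : b * t1 * t2 = a.
  by transitivity (b * (0 - t1) * (0 - t2)); [|rewrite -qE]; ring.
by transitivity (b * t1 * t2 - b * (t1 + t2) * v + b * t2 * v);
  [ring|rewrite prodE sumE a_def; ring].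
Qed.

(** The map z -> i / z sends the right half-plane to the upper one; multiplying a + m v - b by z at
    v = i / z gives this form. *)
Lemma quadratic_hurwitz {R : realType} {a m b z : R[i]} :
  (forall t : R[i], 0 < complex.Im t -> a + m * t + b * t ^+ 2 != 0) ->
  0 < complex.Re z -> a * z + m * 'i%C - b * z != 0.
Proof.
move=> q_neq0 z_gt0.
have z_neq0 : z != 0 by apply: contraTneq z_gt0 => ->; rewrite ltxx.
have v_gt0 : 0 < complex.Im ('i%C / z).
  case: z z_gt0 {z_neq0} => x y /= x_gt0.
  rewrite mul0r mul1r add0r divr_gt0 // ltr_wpDr ?sqr_ge0 //.
  by rewrite exprn_gt0.
have := quadratic_cotangent_neq0 q_neq0 v_gt0.
rewrite -(mulIr_eq0 _ (mulIf z_neq0)).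
by congr (_ != 0); rewrite mulrBl mulrDl mulrA divfK.
Qed.

(* One variable at a time, the weights [1, t, t^2] become [z, i, -z]. *)
Lemma stable_hurwitz_transfer {R : realType} {T I : finType} (L : {set T})
    (k : T -> I -> nat) :
  (forall p e, (k p e <= 2)%N) ->
  (forall t : I -> R[i], (forall e, 0 < complex.Im (t e)) ->
     \sum_(p in L) \prod_e t e ^+ k p e != 0) ->
  forall z : I -> R[i], (forall e, 0 < complex.Re (z e)) ->
     \sum_(p in L) \prod_e
       ('i%C ^+ k p e * (if k p e == 1%N then 1 else z e)) != 0.
Proof.
move=> k_le2 L_stable z z_gt0.
pose w (S : seq I) (t : I -> R[i]) p e : R[i] :=
  if e \in S then 'i%C ^+ k p e * (if k p e == 1%N then 1 else z e)
  else t e ^+ k p e.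
(* Induction on [S] for all [t] at once, since the step varies [t] at the new index. Once [S] lists
   all of [I], the weights are free of [t]. *)
suff wS S t : (forall e, 0 < complex.Im (t e)) ->
    \sum_(p in L) \prod_e w S t p e != 0.
  have := wS (enum I) (fun=> 'i%C) (fun=> ltr01).
  congr (_ != 0); apply: eq_bigr => p _; apply: eq_bigr => e _.
  by rewrite /w mem_enum.
elim: S t => [|e S IH] t t_gt0.
  exact: L_stable.
have [eS|eS] := boolP (e \in S).
  rewrite (eq_bigr (fun p => \prod_f w S t p f)) ?IH // => p _.
  apply: eq_bigr => f _; rewrite /w inE.
  by case: eqP => // ->; rewrite eS.
(* As [C] does not involve [t e], the sum is a quadratic in [t e] with coefficients [M 0], [M 1],
   [M 2]; the new weights at [e] recombine the same three. *)
pose C p := \prod_(f | f != e) w S t p f.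
pose M j := \sum_(p in L | k p e == j) C p.
have splitM (g : nat -> R[i]) : \sum_(p in L) g (k p e) * C p =
    g 0%N * M 0%N + g 1%N * M 1%N + g 2%N * M 2%N.
  rewrite /M !mulr_sumr !big_mkcondr /= -!big_split /=.
  apply: eq_bigr => p _; have := k_le2 p e.
  by case: (k p e) => [|[|[|//]]] _ /=; rewrite ?mulr0 ?addr0 ?add0r.
have -> : \sum_(p in L) \prod_f w (e :: S) t p f =
   M 0%N * z e + M 1%N * 'i%C - M 2%N * z e.
  pose g j : R[i] := 'i%C ^+ j * (if j == 1%N then 1 else z e).
  transitivity (\sum_(p in L) g (k p e) * C p).
    apply: eq_bigr => p _; rewrite (bigD1 e) //= /w !inE eqxx /=.
    congr (_ * _); apply: eq_bigr => f f_neq; rewrite /w !inE.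
    by rewrite (negPf f_neq).
  by rewrite splitM /g /= expr0 expr1 sqr_i; ring.
apply: quadratic_hurwitz => // s s_gt0.
pose t' f := if f == e then s else t f.
have t'_gt0 f : 0 < complex.Im (t' f) by rewrite /t'; case: ifP.
suff <- : \sum_(p in L) \prod_f w S t' p f =
    M 0%N + M 1%N * s + M 2%N * s ^+ 2 by exact: IH.
transitivity (\sum_(p in L) s ^+ k p e * C p).
  apply: eq_bigr => p _; rewrite (bigD1 e) //= /w (negPf eS) /t' eqxx.
  congr (_ * _); apply: eq_bigr => f f_neq; rewrite /w.
  by rewrite (negPf f_neq).
by rewrite splitM expr0 expr1; ring.
Qed.

(** * Counting peaks and valleys of a word *)

(** Infinity exceeds every label, and labels do not repeat. In the empty word the two infinities
    would be adjacent. *)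
Lemma letter_adjacent_neq {n} (pi : 'S_n) k :
  (0 < n)%N -> (k <= n)%N -> letter pi k != letter pi k.+1.
Proof.
move=> n_gt0; have letter_lt j : (j < n)%N -> (letter pi j.+1 < n)%N.
  by move=> jn; rewrite (letterS pi (Ordinal jn)).
case: k => [|k] k_le; first by rewrite letter0 gtn_eqF ?letter_lt.
have [k1n|k1n] := ltnP k.+1 n; last first.
  have k2E : k.+2 = n.+1 by lia.
  by rewrite k2E letter_last ltn_eqF ?letter_lt.
rewrite (letterS pi (Ordinal k_le)) (letterS pi (Ordinal k1n)).
by rewrite (inj_eq val_inj) (inj_eq perm_inj) -val_eqE /=; lia.
Qed.

Definition descent_at {n} (pi : 'S_n) k : bool := (letter pi k.+1 < letter pi k)%N.

Lemma ascent_atE {n} (pi : 'S_n) k : (0 < n)%N -> (k <= n)%N ->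
  (letter pi k < letter pi k.+1)%N = ~~ descent_at pi k.
Proof.
move=> n_gt0 kn; have := letter_adjacent_neq pi k n_gt0 kn.
by rewrite /descent_at; lia.
Qed.

(* The degree of the monomial of [pi] in [z_e], [z_e'] together: 0 for a peak,
   2 for a valley and 1 otherwise. *)
Definition bottom_degree {n} (pi : 'S_n) (e : 'I_n) : nat :=
  (e \in descent_bottoms pi) + (e \in ascent_bottoms pi).

Lemma bottom_degree_perm {n} (pi : 'S_n) (i : 'I_n) :
  bottom_degree pi (pi i) = (descent_at pi i + ~~ descent_at pi i.+1)%N.
Proof.
have n_gt0 : (0 < n)%N by case: (i) => j; apply: leq_ltn_trans.
rewrite /bottom_degree !mem_imset ?inE; try exact: perm_inj.
by rewrite ascent_atE // ltn_ord.
Qed.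

Lemma peak_valley_setE {n} (pi : 'S_n) (e : 'I_n) :
  (e \in peak_valley_set pi) = (bottom_degree pi e != 1%N).
Proof.
rewrite -(permKV pi e); set i := perm_inv pi e.
have n_gt0 : (0 < n)%N by case: (i) => j; apply: leq_ltn_trans.
rewrite bottom_degree_perm !inE !mem_imset ?inE; try exact: perm_inj.
rewrite (ascent_atE pi i) ?(ascent_atE pi i.+1) ?(ltnW (ltn_ord i)) ?ltn_ord //.
rewrite -/(descent_at pi i) -/(descent_at pi i.+1).
by case: (descent_at pi i); case: (descent_at pi i.+1).
Qed.

(** A letter of degree 0 lies strictly inside the word: the first letter is reached by a descent
    from infinity, and the last is left by an ascent to infinity. *)
Lemma peaksE {n} (pi : 'S_n) (i : 'I_n) :
  (i \in peaks pi) = (bottom_degree pi (pi i) == 0%N).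
Proof.
have n_gt0 : (0 < n)%N by case: (i) => j; apply: leq_ltn_trans.
rewrite bottom_degree_perm inE (ascent_atE pi i) ?(ltnW (ltn_ord i)) //.
rewrite -/(descent_at pi i.+1).
have first_descent : i = 0%N :> nat -> descent_at pi i.
  by move=> i0; rewrite /descent_at letterS i0 letter0.
have last_ascent : i.+1 = n -> ~~ descent_at pi i.+1.
  by move=> i1n; rewrite /descent_at letterS i1n letter_last -leqNgt ltnW.
have := ltn_ord i.
by case: (descent_at pi i) first_descent => [_|];
  case: (descent_at pi i.+1) last_ascent => //=; lia.
Qed.

(* The sum telescopes, since the word starts with a descent from infinity and
   ends with an ascent to infinity. *)
Lemma sum_bottom_degree {n} (pi : 'S_n) :
  (\sum_e bottom_degree pi e = n + (0 < n))%N.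
Proof.
have first_descent : descent_at pi 0 = (0 < n)%N.
  rewrite /descent_at letter0; case: n pi => [|n] pi; first by rewrite letter_last.
  by rewrite (letterS pi ord0) ltn_ord.
have last_ascent : descent_at pi n = false.
  rewrite /descent_at letter_last; case: n pi {first_descent} => [|n] pi.
    by rewrite letter0.
  by rewrite (letterS pi ord_max) ltnNge ltnW.
rewrite (reindex_inj (@perm_inj _ pi)) /=.
rewrite (eq_bigr _ (fun i _ => bottom_degree_perm pi i)).
suff partial m : (\sum_(i < m) (descent_at pi i + ~~ descent_at pi i.+1) +
    descent_at pi m = m + descent_at pi 0)%N.
  by have := partial n; rewrite last_ascent addn0 first_descent.
elim: m => [|m IH]; first by rewrite big_ord0.
by rewrite big_ord_recr /= addnA IH; case: (descent_at pi m.+1) => /=; lia.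
Qed.

(** Sum 1 + [d <> 1] = 2 [d = 0] + d, valid for d = 0, 1, 2, over the degrees d of all letters. *)
Lemma card_peak_valley_set {n} (pi : 'S_n) :
  #|peak_valley_set pi| = (#|peaks pi|.*2 + (0 < n))%N.
Proof.
have peakS : #|peaks pi| = (\sum_e (bottom_degree pi e == 0))%N.
  rewrite -sum1_card big_mkcond [RHS](reindex_inj (@perm_inj _ pi)) /=.
  by apply: eq_bigr => i _; rewrite peaksE; case: eqP.
have pvS : #|peak_valley_set pi| = (\sum_e (bottom_degree pi e != 1))%N.
  rewrite -sum1_card big_mkcond; apply: eq_bigr => e _.
  by rewrite peak_valley_setE; case: eqP.
apply: (@addnI n); rewrite addnCA -(sum_bottom_degree pi) pvS peakS -mul2n.
rewrite -[X in (X + _)%N](card_ord n) -sum1_card big_distrr -!big_split /=.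
apply: eq_bigr => e _; rewrite /bottom_degree.
by case: (e \in _); case: (e \in _).
Qed.

(** * Evaluating the polynomials *)

Lemma mv_eulerian_diagonal (K : comNzRingType) n (P : labeled_poset n)
    (t : 'I_n -> K) :
  (mv_eulerian K P).@[fun j => match split j with inl e => t e | inr e => t e end]
  = \sum_(pi in jordan_holder P) \prod_e t e ^+ bottom_degree pi e.
Proof.
rewrite /mv_eulerian rmorph_sum; apply: eq_bigr => pi _ /=.
rewrite rmorphM !rmorph_prod /= [in RHS]/bottom_degree.
under [RHS]eq_bigr => e _ do rewrite exprD.
rewrite big_split /=; congr (_ * _); rewrite big_mkcond; apply: eq_bigr => e _.
  by rewrite mevalXU (unsplitK (inl e)); case: (e \in _).
by rewrite mevalXU (unsplitK (inr e)); case: (e \in _).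
Qed.

Lemma meval_mv_peak (K : comNzRingType) n (P : labeled_poset n) (z : 'I_n -> K) :
  (mv_peak K P).@[z] =
  \sum_(pi in jordan_holder P) \prod_(e in peak_valley_set pi) z e.
Proof.
rewrite /mv_peak rmorph_sum; apply: eq_bigr => pi _ /=.
by rewrite rmorph_prod; apply: eq_bigr => e _; rewrite /= mevalXU.
Qed.

Lemma mv_peak_hurwitz {R : realType} {n} (P : labeled_poset n) :
  stable (mv_eulerian R[i] P) -> hurwitz_stable (mv_peak R[i] P).
Proof.
move=> A_stable z z_gt0; rewrite meval_mv_peak.
have := stable_hurwitz_transfer (jordan_holder P) bottom_degree _ _ z z_gt0.
have -> : \sum_(pi in jordan_holder P) \prod_e ('i%C ^+ bottom_degree pi e *
      (if bottom_degree pi e == 1%N then 1 else z e)) =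
    'i%C ^+ (n + (0 < n)) *
    \sum_(pi in jordan_holder P) \prod_(e in peak_valley_set pi) z e.
  rewrite mulr_sumr; apply: eq_bigr => pi _.
  rewrite big_split /= prodrXr sum_bottom_degree [in RHS]big_mkcond /=.
  by congr (_ * _); apply: eq_bigr => e _; rewrite peak_valley_setE; case: eqP.
move=> H; have : 'i%C ^+ (n + (0 < n)) *
    \sum_(pi in jordan_holder P) \prod_(e in peak_valley_set pi) z e != 0.
  apply: H => [pi e|t t_gt0].
    by rewrite /bottom_degree; case: (e \in _); case: (e \in _).
  rewrite -mv_eulerian_diagonal; apply: A_stable => j.
  by case: (split j).
by rewrite mulf_eq0 negb_or => /andP[].
Qed.

(** One of the two square roots has the right sign unless both are purely imaginary, and then x
    would be real. *)
Lemma sqrt_Re_gt0 {R : realType} {x : R[i]} :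
  complex.Im x != 0 -> exists2 y, 0 < complex.Re y & y ^+ 2 = x.
Proof.
move=> x_neq0; have yE := sqr_sqrtc x; move: (sqrtc x) yE => y yE.
have [y_gt0|y_lt0|y0] := ltrgtP 0 (complex.Re y).
- by exists y.
- exists (- y); last by rewrite sqrrN.
  by case: y y_lt0 {yE} => a b /=; rewrite oppr_gt0.
- case/eqP: x_neq0; rewrite -yE; case: y y0 {yE} => a b /= <-; ring.
Qed.

Theorem proposition5p3 (R : realType) (n : nat) (P : labeled_poset n) :
  stable (mv_eulerian R[i] P) ->
  hurwitz_stable (mv_peak R[i] P) /\ real_rooted (peak_poly R P).
Proof.
move=> A_stable; have peak_hurwitz := mv_peak_hurwitz P A_stable.
split=> // x x_root; apply/eqP/negPn/negP => /sqrt_Re_gt0[y y_gt0 yx].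
have := peak_hurwitz (fun=> y) (fun=> y_gt0); rewrite meval_mv_peak.
(* A word with p peaks has 2p + 1 peaks and valleys, except that the empty word has none; hence the
   exponent [(0 < n)]. *)
suff -> : \sum_(pi in jordan_holder P) \prod_(e in peak_valley_set pi) y =
    y ^+ (0 < n) * (map_poly (real_complex R) (peak_poly R P)).[x].
  by rewrite (eqP x_root) mulr0 eqxx.
rewrite /peak_poly rmorph_sum horner_sum mulr_sumr.
apply: eq_bigr => pi _; rewrite /= map_polyXn hornerXn prodr_const.
by rewrite card_peak_valley_set -yx -exprM mul2n -exprD addnC.
Qed.
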